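(* Let $f:E\to\mathbb{R}$ be proper, lower semi-continuous, bounded from below and $L$-smooth with $L>0$ (not necessarily convex). Let $0<\gamma<\frac2L$, $x_0\in E$, and let $(x_n)_{n\in\mathbb{N}}$ be given by the gradient descent algorithm $x_{n+1}=x_n-\gamma\nabla f(x_n)$. Then: (i) $f(x_n)$ is non-increasing and converges. (ii) The sequence $\|x_{n+1}-x_n\|$ converges to $0$, with rate $\min_{n<N}\|x_{n+1}-x_n\|=\mathcal{O}(1/\sqrt N)$. (iii) All cluster points of the sequence $(x_n)$ are critical points of $f$, i.e. points $x$ with $\nabla f(x)=0$.
   Context: $E$ is a finite-dimensional Euclidean space with norm $\|\cdot\|$. $f$ is $L$-smooth if it is differentiable and $\|\nabla f(x)-\nabla f(y)\|\le L\|x-y\|$ for all $x,y\in E$. *)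

(* Defs.v *)
From HB Require Import structures.
From mathcomp Require Import all_boot all_order all_algebra.
From mathcomp Require Import all_classical all_reals all_analysis.
Import Order.TTheory GRing.Theory Num.Theory.
Import numFieldNormedType.Exports.

Set Implicit Arguments.
Unset Strict Implicit.
Unset Printing Implicit Defensive.

Local Open Scope classical_set_scope.
Local Open Scope ring_scope.

(* A Euclidean space is a finite-dimensional real normed space whose norm is
   the one of an inner product. The topology is the one of the norm, being
   part of normedModType. The type 'rV[R]_n cannot serve here, since the norm
   that the library puts on it is the sup norm. *)
HB.mixin Record NormedVector_isEuclidean (R : realType) (E : Type)
    & NormedModule R E & Vector R E := {
  inner : {dot E for (@idfun R)} ;
  sqr_norm_inner : forall u : E, `|u| ^+ 2 = inner u u
}.

#[short(type="euclideanType")]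
HB.structure Definition Euclidean (R : realType) :=
  {E of NormedVector_isEuclidean R E & NormedModule R E & Vector R E}.

Section Definitions.
Context {R : realType} {E : euclideanType R}.
Implicit Types (f : E -> R) (x : E).

(* The vector representing the differential for the inner product. It exists
   and is unique when f is differentiable at x, by the Riesz theorem. *)
Definition grad f x : E :=
  get [set g : E | forall v : E, 'd f x v = inner g v].

Definition smooth_with (L : R) f : Prop :=
  (forall x, differentiable f x) /\
  (forall x y, `|grad f x - grad f y| <= L * `|x - y|).

End Definitions.

Definition proper_fun {T : Type} {R : realType} (g : T -> \bar R) : Prop :=
  (forall x, g x != -oo%E) /\ (exists x, g x != +oo%E).

(* The minimum of d n over n < N. The seed d 0 is itself one of the values
   whenever N > 0; the value at N = 0 is conventional. *)
Definition min_below {R : realType} (d : nat -> R) (N : nat) : R :=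
  \big[Num.min/d 0%N]_(n < N) d n.

(* Main.v *)
(* Smoothness gives the descent inequality
     f y <= f x + <grad f x, y - x> + L/2 |y - x|^2,
   so that a gradient step satisfies
     f (x_(n+1)) <= f (x_n) - c |x_(n+1) - x_n|^2,  c = 1/gamma - L/2 > 0.
   Since f is bounded below, the squared steps are summable with sum at most
   (f (x_0) - inf f) / c, which gives (i) and (ii). Then grad f (x_n) -> 0 and
   (iii) follows from the continuity of grad f. *)
From HB Require Import structures.
Require Import Defs.
From mathcomp Require Import all_boot all_order all_algebra.
From mathcomp Require Import all_classical all_reals all_analysis.
From mathcomp Require Import ring lra.
Import Order.TTheory GRing.Theory Num.Theory.
Import numFieldNormedType.Exports.

Local Open Scope classical_set_scope.
Local Open Scope ring_scope.

Section EuclideanSpace.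
Context {R : realType} {E : euclideanType R}.
Implicit Types u v w : E.

Lemma innerC u v : inner u v = inner v u.
Proof. by rewrite hermC/= expr0 mul1r. Qed.

Lemma inner_le_norm u v : inner u v <= `|u| * `|v|.
Proof.
(* Cauchy-Schwarz is the squared triangle inequality, expanded. *)
have : `|u + v| ^+ 2 <= (`|u| + `|v|) ^+ 2.
  by rewrite lerXn2r ?nnegrE ?addr_ge0 ?normr_ge0// ler_normD.
rewrite sqr_norm_inner sqrrD !sqr_norm_inner linearDl !linearDr/=.
rewrite (innerC v u); lra.
Qed.

(** A linear form is determined by its values on the basis [b], so it suffices that [phi], sending
    [g] to the row of these values of [inner g], be onto. It is injective by definiteness, tested at
    [u - v], hence onto by equality of dimensions. *)
Lemma riesz (l : {linear E -> R^o}) : exists g, forall v, l v = inner g v.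
Proof.
pose n := \dim (fullv : {vspace E}).
pose b : n.-tuple E := vbasis fullv.
pose phi g : 'rV[R]_n := \row_i inner g b`_i.
have phi_lin : linear phi.
  by move=> a u v; apply/rowP => i; rewrite !mxE linearDl/= linearZl_LR.
pose phiL : {linear E -> 'rV[R]_n} :=
  HB.pack phi (GRing.isLinear.Build _ _ _ _ _ phi_lin).
have eq_b (k1 k2 : {linear E -> R^o}) :
    (forall i : 'I_n, k1 b`_i = k2 b`_i) -> k1 =1 k2.
  move=> k12 v; rewrite (coord_basis (vbasisP fullv) (memvf v)) !linear_sum.
  by apply: eq_bigr => i _; rewrite !linearZ/= k12.
have ker0 : lker (linfun phiL) == 0%VS.
  apply/lker0P => u v; rewrite !lfunE/= => uv.
  have /(_ (u - v)) : inner u =1 inner v.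
    apply: (eq_b (inner u) (inner v)) => i.
    by have /rowP/(_ i) := uv; rewrite !mxE.
  move/eqP; rewrite -subr_eq0 -linearBl/= -sqr_norm_inner.
  by rewrite expf_eq0/= normr_eq0 subr_eq0 => /eqP.
have surj : limg (linfun phiL) = fullv.
  apply/eqP; rewrite eqEdim subvf/= limg_dim_eq; last first.
    by rewrite (eqP ker0) capv0.
  by rewrite dimvf/= /dim/= mul1n.
have /memv_imgP[g _] : \row_i l b`_i \in limg (linfun phiL).
  by rewrite surj memvf.
rewrite lfunE/= => /rowP lg; exists g; apply: (eq_b l (inner g)) => i.
by have := lg i; rewrite !mxE.
Qed.

(** [grad] is a choice by [get], so its specification follows from the existence of one representing
    vector. *)
Lemma gradP (f : E -> R) x v : 'd f x v = inner (grad f x) v.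
Proof.
have [g lg] := riesz ('d f x).
have : [set g | forall v, 'd f x v = inner g v] (grad f x) by apply: getI lg.
exact.
Qed.

End EuclideanSpace.

(* The two difference quotients coincide. *)
Lemma is_derive_line (R : realType) (V W : normedModType R) (f : V -> W)
    (x d : V) (t : R) (df : W) :
  is_derive (x + t *: d) d f df ->
  is_derive t 1 (fun s : R => f (x + s *: d)) df.
Proof.
pose g (s : R) := f (x + s *: d).
have quotE : (fun h : R => h^-1 *: ((g \o shift t) (h *: (1 : R)) - g t)) =
    (fun h : R =>
      h^-1 *: ((f \o shift (x + t *: d)) (h *: d) - f (x + t *: d))).
  apply/funext => h /=; rewrite /g.
  by rewrite [h *: 1]mulr1 scalerDl addrCA.
by move=> [dv <-]; split; rewrite /derivable /derive quotE.
Qed.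

Section Smooth.
Context {R : realType} {E : euclideanType R}.
Variables (f : E -> R) (L : R).
Hypothesis fL : smooth_with L f.

(** On the segment from [x] to [y], subtract from [f] the linear and quadratic terms of the bound.
    By Cauchy-Schwarz and the Lipschitz gradient, the derivative of the remainder is nonpositive,
    and the mean value theorem concludes without integrating. *)
Lemma smooth_descent x y :
  f y <= f x + inner (grad f x) (y - x) + L / 2 * `|y - x| ^+ 2.
Proof.
have [df lip] := fL; pose d := y - x; rewrite -/d.
pose p (t : R) := f (x + t *: d).
pose a := inner (grad f x) d; pose b := L / 2 * `|d| ^+ 2.
(* The descent inequality is [psi 1 <= psi 0]. *)
pose psi t := p t - (a * t + b * t ^+ 2).
have dpsi (t : R) : is_derive t 1 psi
    (inner (grad f (x + t *: d)) d - (a + b * (2 * t))).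
  have dp : is_derive t 1 p (inner (grad f (x + t *: d)) d).
    apply: is_derive_line; rewrite -gradP -deriveE//.
    exact/derivableP/diff_derivable.
  rewrite /psi; apply: is_deriveB.
  apply: is_derive_eq; rewrite /GRing.scale/=; ring.
have [|c c01] := MVT_segment (@ler01 R) (fun t _ => dpsi t).
  apply: derivable_within_continuous => t _.
  by have [] := dpsi t.
rewrite /psi /p scale1r scale0r addr0 [x + d]addrC subrK => eq_psi.
have : inner (grad f (x + c *: d) - grad f x) d <= L * `|c *: d| * `|d|.
  apply: le_trans (inner_le_norm _ _) _.
  by rewrite ler_wpM2r// (le_trans (lip _ _))// addrAC subrr add0r.
move: c01; rewrite in_itv/= => /andP[c0 c1].
rewrite linearBl/= normrZ (ger0_norm c0) -/a => le_inner.
(* The Lipschitz bound is exactly the derivative of [b * t ^+ 2] at [c], which makes the derivative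
   of [psi] at [c] nonpositive. *)
have bE : L * (c * `|d|) * `|d| = b * (2 * c) by rewrite /b; field.
rewrite bE in le_inner; rewrite -/b; move: eq_psi le_inner.
rewrite !(mulr0, mulr1, expr1n, expr0n, subr0, addr0)/=.
by move: (inner _ d) (b * (2 * c)) => k k' eq_psi le_inner; lra.
Qed.

End Smooth.

Section SufficientDecrease.
Context {R : realType}.
(** [u] stands for the objective values along the iterates, [s] for the step lengths. *)
Variables (u s : nat -> R) (c m : R).
Hypotheses (c_gt0 : 0 < c) (s_ge0 : forall n, 0 <= s n).
Hypothesis u_ge : forall n, m <= u n.
Hypothesis u_decr : forall n, u n.+1 <= u n - c * s n ^+ 2.

Lemma sufficient_decrease_nonincreasing : nonincreasing_seq u.
Proof.
apply/nonincreasing_seqP => n; apply: le_trans (u_decr n) _.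
by rewrite gerBl mulr_ge0 ?sqr_ge0// ltW.
Qed.

Lemma sufficient_decrease_cvg : cvgn u.
Proof.
apply: nonincreasing_is_cvgn sufficient_decrease_nonincreasing _.
by exists m => _ [n _ <-].
Qed.

(** The squares are squeezed between 0 and a multiple of [u n - u n.+1], which vanishes because [u]
    converges. *)
Lemma sufficient_decrease_step_cvg0 : s @ \oo --> (0 : R).
Proof.
have du0 : c^-1 * (u n - u n.+1) @[n --> \oo] --> (0 : R).
  rewrite -(mulr0 c^-1) -(subrr (limn u)); apply: cvgMr.
  have cu := sufficient_decrease_cvg.
  by apply: cvgB => //; rewrite cvg_shiftS.
have s2 : s n ^+ 2 @[n --> \oo] --> (0 : R).
  apply: squeeze_cvgr (cvg_cst (0 : R)) du0.
  apply: nearW => n; rewrite sqr_ge0/= ler_pdivlMl// lerBrDr.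
  by have := u_decr n; lra.
have -> : s = (fun n => Num.sqrt (s n ^+ 2)).
  by apply/funext => n; rewrite sqrtr_sqr ger0_norm.
rewrite -sqrtr0; apply: continuous_cvg s2.
exact: sqrt_continuous.
Qed.

Lemma min_below_ge0 N : 0 <= min_below s N.
Proof. by rewrite /min_below; apply/bigmin_geP; split. Qed.

(** Each of the [N] decreases is at least [c] times the squared minimum, and their sum telescopes to
    [u 0 - u N]. *)
Lemma sufficient_decrease_min N :
  N%:R * min_below s N ^+ 2 <= c^-1 * (u 0 - m).
Proof.
rewrite ler_pdivlMl// mulrA.
apply: (@le_trans _ _ (u 0 - u N)); last exact: lerB.
have -> : u 0 - u N = \sum_(i < N) (u i - u i.+1).
  rewrite -(big_mkord xpredT (fun i => u i - u i.+1)) -opprB.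
  rewrite -telescope_sumr// -sumrN.
  by apply: eq_bigr => i _; rewrite opprB.
have -> : c * N%:R * min_below s N ^+ 2 =
    \sum_(i < N) c * min_below s N ^+ 2.
  by rewrite sumr_const card_ord -[RHS]mulr_natl; ring.
apply: ler_sum => i _.
apply: (@le_trans _ _ (c * s i ^+ 2)); last by rewrite lerBrDl -lerBrDr.
rewrite ler_pM2l// lerXn2r ?nnegrE ?min_below_ge0//.
exact: (bigmin_le _ i (fun j : 'I_N => s j)).
Qed.

Lemma sufficient_decrease_rate :
  min_below s =O_\oo (fun N : nat => 1 / Num.sqrt (N%:R : R)).
Proof.
apply/eqOP; near=> k; near=> N.
have N0 : (0 < N)%N by near: N; exact: nbhs_infty_gt.
have sN0 : 0 < Num.sqrt (N%:R : R) by rewrite sqrtr_gt0 ltr0n.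
rewrite ger0_norm ?min_below_ge0// div1r gtr0_norm ?invr_gt0//.
rewrite ler_pdivlMr//.
(* The right-hand side does not depend on [N], so any [k] above it serves as the constant of the big
   O. *)
have : min_below s N * Num.sqrt N%:R <= Num.sqrt (c^-1 * (u 0 - m)).
  rewrite -[X in X * _]ger0_norm ?min_below_ge0// -sqrtr_sqr -sqrtrM ?sqr_ge0//.
  by rewrite ler_wsqrtr// mulrC sufficient_decrease_min.
move/le_trans; apply.
near: k; exact: nbhs_pinfty_ge.
Unshelve. all: by end_near. Qed.

End SufficientDecrease.

Theorem proposition20 (R : realType) (E : euclideanType R)
    (f : E -> R) (L gamma : R) (x0 : E) (x : nat -> E)
    (f_proper : proper_fun (EFin \o f))
    (f_lsc : lower_semicontinuous (EFin \o f))
    (f_bounded_below : has_lbound (range f))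
    (L_gt0 : 0 < L)
    (f_smooth : smooth_with L f)
    (gamma_gt0 : 0 < gamma)
    (gamma_lt : gamma < 2 / L)
    (x_init : x 0%N = x0)
    (x_step : forall n : nat, x n.+1 = x n - gamma *: grad f (x n)) :
  [/\ nonincreasing_seq (f \o x) /\ cvgn (f \o x),
      (fun n : nat => `|x n.+1 - x n|) @ \oo --> (0 : R) /\
      min_below (fun n : nat => `|x n.+1 - x n|)
        =O_\oo (fun N : nat => 1 / Num.sqrt (N%:R : R)) &
      forall c : E, cluster (x @ \oo) c -> grad f c = 0].
Proof.
have [m f_ge] := f_bounded_below.
have fx_ge n : m <= (f \o x) n by apply: f_ge; exists (x n).
pose s n := `|x n.+1 - x n|.
have s_ge0 n : 0 <= s n by exact: normr_ge0.
pose c := gamma^-1 - L / 2.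
have c_gt0 : 0 < c.
  rewrite subr_gt0 -[ltLHS]invrK ltf_pV2 ?posrE ?invr_gt0 ?divr_gt0//.
  by rewrite invf_div.
have stepE n : x n.+1 - x n = - gamma *: grad f (x n).
  by rewrite x_step addrAC subrr add0r scaleNr.
have decr n : (f \o x) n.+1 <= (f \o x) n - c * s n ^+ 2.
  apply: le_trans (smooth_descent f L f_smooth (x n) (x n.+1)) _.
  (* Written through the step, the gradient turns the inner product of the descent inequality into
     [- gamma^-1] times the squared step. *)
  have -> : grad f (x n) = - gamma^-1 *: (x n.+1 - x n).
    by rewrite stepE scalerA mulrNN mulVf ?gt_eqF// scale1r.
  rewrite linearZl_LR/= -sqr_norm_inner /c /s; lra.
have s_cvg0 := sufficient_decrease_step_cvg0 _ _ _ _ c_gt0 s_ge0 fx_ge decr.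
split; first split.
- exact: sufficient_decrease_nonincreasing c_gt0 decr.
- exact: sufficient_decrease_cvg c_gt0 fx_ge decr.
- by split=> //; exact: sufficient_decrease_rate c_gt0 s_ge0 fx_ge decr.
move=> p clp; apply/eqP; rewrite -normr_le0; apply/ler_addgt0Pr => e e_gt0.
(* A step has length [gamma] times the norm of the gradient, hence the threshold [gamma * (e / 2)]
   on steps. *)
have small_grad : (x @ \oo) [set y | `|grad f y| < e / 2].
  have ge_gt0 : 0 < gamma * (e / 2) by rewrite !mulr_gt0.
  have /cvgr0Pnorm_lt/(_ _ ge_gt0) := s_cvg0.
  apply: filterS => n /=; rewrite /s stepE normr_id normrZ normrN gtr0_norm//.
  by rewrite ltr_pM2l.
have near_p : nbhs p [set y | `|p - y| < e / 2 / L].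
  by apply/nbhs_normP; exists (e / 2 / L); rewrite //= !divr_gt0.
(* Clustering gives a point [y] in both sets, so no subsequence is extracted. The gradient at [y]
   and its variation from [y] to [p] each contribute at most [e / 2]. *)
have [y [/= gy yp]] := clp _ _ small_grad near_p.
rewrite add0r -[grad f p](subrK (grad f y)) (le_trans (ler_normD _ _))//.
rewrite [leRHS]splitr lerD ?(ltW gy)//.
have [_ lip] := f_smooth; apply: le_trans (lip p y) _.
by rewrite mulrC -ler_pdivlMr// ltW.
Qed.
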